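(* Let $(z_n)_{n\ge 2}$ be integers with $z_2=2$ and $z_n\ge 2$ for all $n\ge 3$, define $x_1=1$ and $x_n=\prod_{j=2}^{n} z_j^{2^{n-j}}$ for $n\ge 2$, let $S_n=\sum_{j=1}^{n}\frac{1}{x_j}$ and $S=\sum_{j=1}^{\infty}\frac{1}{x_j}$. For $n\ge 4$ put $\ell_n=5\cdot 2^{n-3}$, and define finite sequences $(a_j^{(n)})_{j=0}^{\ell_n-1}$ recursively by $$(a_0^{(4)},\ldots,a_9^{(4)})=(1,\ 1,\ 1,\ z_3-1,\ 2,\ z_4-1,\ 1,\ 1,\ z_3-1,\ 2),$$ and for $n\ge 4$: $a_j^{(n+1)}=a_j^{(n)}$ for $j=0,\ldots,\ell_n-2$; $a_{\ell_n-1}^{(n+1)}=1$, $a_{\ell_n}^{(n+1)}=1$, $a_{\ell_n+1}^{(n+1)}=z_{n+1}-1$; $a_j^{(n+1)}=a_{2\ell_n-j+1}^{(n)}$ for $j=\ell_n+2,\ldots,2\ell_n-2$; and $a_{2\ell_n-1}^{(n+1)}=2$. Then for every $n\ge 4$ one has $S_n=[a_0^{(n)};a_1^{(n)},\ldots,a_{\ell_n-1}^{(n)}]$, and, setting $a_j=\lim_{n\to\infty}a_j^{(n)}$ for each $j\ge0$ (the sequence $a_j^{(n)}$ being eventually constant in $n$), $$S=[a_0;a_1,a_2,\ldots]=[1;\ 1,\ 1,\ z_3-1,\ 2,\ z_4-1,\ 1,\ \ldots].$$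
   Context: $[a_0;a_1,\ldots,a_m]$ denotes the finite continued fraction $a_0+\cfrac{1}{a_1+\cfrac{1}{\ddots+\cfrac{1}{a_m}}}$, and $[a_0;a_1,a_2,\ldots]$ denotes the infinite continued fraction, the limit of $[a_0;a_1,\ldots,a_m]$ as $m\to\infty$. *)

(* Defs.v *)
From mathcomp Require Import all_boot all_order all_algebra.

Set Implicit Arguments.
Unset Strict Implicit.
Unset Printing Implicit Defensive.

Import GRing.Theory.
Local Open Scope ring_scope.

(* [a_0; a_1, ..., a_m], where m is the index of the last partial quotient. *)
Fixpoint cfrac (F : fieldType) (a : nat -> int) (m : nat) : F :=
  match m with
  | 0%N => (a 0%N)%:~R
  | m'.+1 => (a 0%N)%:~R + (cfrac F (fun j => a j.+1) m')^-1
  end.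

(* For n = 1 the product is empty, so that xs z 1 = 1. *)
Definition xs (z : nat -> int) (n : nat) : int :=
  \prod_(2 <= j < n.+1) z j ^+ (2 ^ (n - j))%N.

Definition len (n : nat) : nat := (5 * 2 ^ (n - 3))%N.

Definition pq4 (z : nat -> int) : seq int :=
  [:: 1; 1; 1; z 3%N - 1; 2; z 4%N - 1; 1; 1; z 3%N - 1; 2].

(* [pqS l y a] is the sequence of length 2 * l obtained from the sequence a of
   length l, where y plays the role of z_{n+1}; it is 0 out of range. *)
Definition pqS (l : nat) (y : int) (a : nat -> int) (j : nat) : int :=
  if (j <= l - 2)%N then a j
  else if j == (l - 1)%N then 1
  else if j == l then 1
  else if j == l.+1 then y - 1
  else if (j <= 2 * l - 2)%N then a (2 * l - j + 1)%N
  else if j == (2 * l - 1)%N then 2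
  else 0.

(* [pq z n j] is a_j^{(n)}; only n >= 4 and j < len n are meaningful. *)
Fixpoint pq (z : nat -> int) (n : nat) : nat -> int :=
  match n with
  | 0%N => nth 0 (pq4 z)
  | m.+1 => if (m < 4)%N then nth 0 (pq4 z)
            else pqS (len m) (z m.+1) (pq z m)
  end.

(* Main.v *)
Require Import Defs.
From mathcomp Require Import all_boot all_order all_algebra.
From mathcomp Require Import zify ring lra.
From mathcomp Require Import all_classical all_reals all_analysis.

Set Implicit Arguments.
Unset Strict Implicit.
Unset Printing Implicit Defensive.

Import Order.TTheory GRing.Theory Num.Theory.
Import numFieldNormedType.Exports.
Local Open Scope classical_set_scope.
Local Open Scope ring_scope.

(** With [M x = [[x, 1], [1, 0]]], the value of [a_0; ..., a_m] is the quotient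
    p / q of the first column of [P s = M a_0 * ... * M a_m], where
    [s = (a_0, ..., a_m)], and [P (rev s)] is the transpose of [P s].
    The partial quotients of level n have the form (1, 1, 1, t, 2), and those of
    level n+1 are (1, 1, 1, t', 2) with t' = (t, 1, 1, z_{n+1} - 1, 2, rev t).
    As t has even length, [P t] has determinant 1, and multiplying out gives
    q' = z_{n+1} q^2 and p' = z_{n+1} q p + 1, i.e. p'/q' = p/q + 1/(z_{n+1} q^2);
    hence q = x_n and p/q = S_n by induction.  The m-th convergent p_m/q_m of the
    limit sequence is also a convergent of S_n for large n, so it lies within
    1/q_m <= 1/m of S_n, which gives the convergence to S. *)

(** * Matrix products of continued fractions *)

Definition cfmx (x : int) : 'M[int]_2 :=
  \matrix_(i, j) (if i == 0 then (if j == 0 then x else 1)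
                  else (if j == 0 then 1 else 0)).

Definition cfprod (s : seq int) : 'M[int]_2 := \prod_(x <- s) cfmx x.

Lemma mulmx2E (A B : 'M[int]_2) i j :
  (A * B) i j = A i 0 * B 0 j + A i 1 * B 1 j.
Proof.
rewrite -[A * B]/(A *m B) mxE big_ord_recl big_ord1.
by rewrite (_ : lift ord0 ord0 = 1) //; apply: val_inj.
Qed.

Lemma cfmxE x :
  (cfmx x 0 0 = x) * (cfmx x 0 1 = 1) * (cfmx x 1 0 = 1) * (cfmx x 1 1 = 0).
Proof. by rewrite !mxE. Qed.

Lemma cfprod_cons x s : cfprod (x :: s) = cfmx x * cfprod s.
Proof. by rewrite /cfprod big_cons. Qed.

Lemma cfprod_cat s1 s2 : cfprod (s1 ++ s2) = cfprod s1 * cfprod s2.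
Proof. by rewrite /cfprod big_cat. Qed.

Lemma cfprod_nil : cfprod [::] = 1.
Proof. by rewrite /cfprod big_nil. Qed.

Lemma cfprod_nilE : (cfprod [::] 0 0 = 1) * (cfprod [::] 1 0 = 0).
Proof. by rewrite cfprod_nil !mxE. Qed.

(** Each factor [cfmx x] is symmetric, so transposing the product only reverses the order of its
    factors. *)
Lemma cfprod_rev s : cfprod (rev s) = (cfprod s)^T.
Proof.
elim: s => [|x s IHs]; first by rewrite cfprod_nil trmx1.
rewrite rev_cons -cats1 cfprod_cat cfprod_cons IHs cfprod_cons cfprod_nil mulr1.
rewrite [RHS]trmx_mul; congr (_ *m _).
by apply/matrixP=> i j; rewrite !mxE; case: (i == 0); case: (j == 0).
Qed.

Lemma cfprod_det s :
  cfprod s 0 0 * cfprod s 1 1 - cfprod s 0 1 * cfprod s 1 0 = (-1) ^+ size s.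
Proof.
elim: s => [|x s IHs]; first by rewrite cfprod_nil !mxE.
rewrite cfprod_cons !mulmx2E !cfmxE /= exprS -IHs; ring.
Qed.

Lemma cfprod_cons0 x s j : cfprod (x :: s) 0 j = x * cfprod s 0 j + cfprod s 1 j.
Proof. by rewrite cfprod_cons mulmx2E !cfmxE mul1r. Qed.

Lemma cfprod_cons1 x s j : cfprod (x :: s) 1 j = cfprod s 0 j.
Proof. by rewrite cfprod_cons mulmx2E !cfmxE mul1r mul0r addr0. Qed.

(** * Positive partial quotients: growth and distance between convergents *)

Definition posseq : pred (seq int) := all (fun x => 1 <= x).

Lemma posseq_cat s1 s2 : posseq (s1 ++ s2) = posseq s1 && posseq s2.
Proof. exact: all_cat. Qed.

Lemma cfprod_bounds s : posseq s ->
  [/\ 1 <= cfprod s 0 0, 0 <= cfprod s 1 0 & cfprod s 1 0 <= cfprod s 0 0].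
Proof.
elim: s => [|x s IHs] /=; first by rewrite cfprod_nil !mxE.
case/andP=> x1 /IHs [h1 h2 h3]; rewrite cfprod_cons0 cfprod_cons1.
split; nia.
Qed.

Lemma cfprod_col1_ge0 s : posseq s -> 0 <= cfprod s 0 1 /\ 0 <= cfprod s 1 1.
Proof.
elim: s => [|x s IHs] /=; first by rewrite cfprod_nil !mxE.
case/andP=> x1 /IHs [h1 h2]; rewrite cfprod_cons !mulmx2E !cfmxE; split; nia.
Qed.

(** Writing [K s] for the upper left entry, [K (x :: y :: s) = x * K (y :: s) + K s] with
    [K s >= 1], so each further term adds at least 1. *)
Lemma cfprod_ge_size s : posseq s -> (size s)%:Z <= cfprod s 0 0.
Proof.
case: s => [|x s]; first by rewrite cfprod_nil mxE.
elim: s x => [|y s IHs] x /= /andP[x1 hs].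
  by rewrite cfprod_cons0 !cfprod_nilE mulr1 addr0.
have h := IHs y hs; have [k1 _ _] := cfprod_bounds (hs : posseq (y :: s)).
case/andP: hs => y1 hs; have [h1 _ _] := cfprod_bounds hs.
by rewrite cfprod_cons0 cfprod_cons1; move: h => /=; nia.
Qed.

Lemma eq_cfrac (F : fieldType) (a b : nat -> int) m :
  (forall j, (j <= m)%N -> a j = b j) -> cfrac F a m = cfrac F b m.
Proof.
elim: m a b => [|m IHm] a b eq_ab /=; rewrite eq_ab //.
by congr (_ + _^-1); apply: IHm => j jm; apply: eq_ab.
Qed.

(** If the tail has first column [(p, q)], prepending [x] turns it into [(x p + q, p)], whose
    quotient is [x + q / p]; positivity ensures [p != 0]. *)
Lemma cfrac_cfprod (F : numFieldType) x s : posseq (x :: s) ->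
  cfrac F (nth 0 (x :: s)) (size s) =
  (cfprod (x :: s) 0 0)%:~R / (cfprod (x :: s) 1 0)%:~R.
Proof.
elim: s x => [|y s IHs] x.
  by rewrite /= cfprod_cons0 cfprod_cons1 !cfprod_nilE mulr1 addr0 divr1.
move=> /= /andP[_ hs]; rewrite [cfrac _ _ _](IHs y hs).
have [h1 _ _] := cfprod_bounds (hs : posseq (y :: s)).
rewrite (cfprod_cons0 x) (cfprod_cons1 x) invf_div rmorphD rmorphM /= mulrDl mulfK //.
by rewrite intr_eq0; lia.
Qed.

(* Up to sign the two values differ by [d / (q * (q c + q' d))], where [(q, q')] is
   the second row of the matrix of [s1] and [(c, d)] the first column of that of
   [s2]; moreover [d <= c]. *)
Lemma cfprod_prefix (F : numFieldType) s1 s2 : posseq (s1 ++ s2) ->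
  (1 < size s1)%N ->
  `|(cfprod s1 0 0)%:~R / (cfprod s1 1 0)%:~R -
    (cfprod (s1 ++ s2) 0 0)%:~R / (cfprod (s1 ++ s2) 1 0)%:~R| <=
  (size s1).-1%:R^-1 :> F.
Proof.
case: s1 => [|x s1] //= /andP[x1]; rewrite posseq_cat => /andP[hs1 hs2] ss1.
have hs : posseq (x :: s1) by rewrite /= x1.
have hq := cfprod_ge_size hs1.
have hd := cfprod_det (x :: s1).
have [c1 d0 dc] := cfprod_bounds hs2.
have qe := cfprod_cons1 x s1.
have qe' : 0 <= cfprod (x :: s1) 1 1.
  have [h _] := cfprod_col1_ge0 hs1.
  by rewrite cfprod_cons mulmx2E !cfmxE mul1r mul0r addr0.
rewrite -cat_cons cfprod_cat !mulmx2E.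
move: hd qe qe'; set p := cfprod _ 0 0; set p' := cfprod _ 0 1.
set q := cfprod _ 1 0; set q' := cfprod _ 1 1 => hd qe qe'.
move: c1 d0 dc; set c := cfprod _ 0 0; set d := cfprod _ 1 0 => c1 d0 dc.
(* The denominator [q] is the upper left entry of the tail [s1] without [x], hence the predecessor
   of the size in the bound. *)
rewrite -qe in hq.
have q1 : 1 <= q by move: hq ss1; lia.
have D1 : q * d <= q * c + q' * d by nia.
have D0 : 1 <= q * c + q' * d by nia.
have qF : (q%:~R : F) != 0 by rewrite intr_eq0; lia.
have DF : ((q * c + q' * d)%:~R : F) != 0 by rewrite intr_eq0; lia.
have -> : p%:~R / q%:~R - (p * c + p' * d)%:~R / (q * c + q' * d)%:~R =
   ((p * q' - p' * q) * d)%:~R / (q * (q * c + q' * d))%:~R :> F.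
  rewrite -mulNr addf_div // -!rmorphM /= -rmorphN /= -!rmorphM -rmorphD /=.
  by congr (_%:~R / _%:~R); ring.
rewrite hd normrM normfV -!intr_norm !normrM normrX normrN1 expr1n mul1r.
rewrite (ger0_norm d0) !ger0_norm; [|nia..].
have n0 : (0 : F) < (size s1)%:R by rewrite ltr0n.
rewrite -[leRHS]mul1r ler_pdivrMr ?ltr0z; last nia.
rewrite mul1r mulrC ler_pdivlMr // -[(size s1)%:R]/((size s1)%:Z%:~R) -rmorphM ler_int /=; nia.
Qed.

(** * Folding: from level n to level n + 1 *)

Definition frame (t : seq int) : seq int := [:: 1, 1, 1 & t ++ [:: 2]].

Definition fold_core (y : int) (t : seq int) : seq int :=
  t ++ [:: 1, 1, y - 1, 2 & rev t].

(** The index is shifted: [core z k] is the middle part of level [k + 4], so passing to [k'.+1]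
    brings in [z (k' + 5)]. *)
Fixpoint core (z : nat -> int) (k : nat) : seq int :=
  if k is k'.+1 then fold_core (z (k' + 5)%N) (core z k')
  else [:: z 3%N - 1; 2; z 4%N - 1; 1; 1; z 3%N - 1].

Lemma size_core z k : (size (core z k) + 4 = len (k + 4))%N.
Proof.
rewrite /len (_ : k + 4 - 3 = k.+1)%N; last lia.
elim: k => [|k IHk] //=.
by rewrite !size_cat /= size_rev expnS; lia.
Qed.

Lemma odd_size_core z k : ~~ odd (size (core z k)).
Proof. by case: k => [|k] //=; rewrite !size_cat /= size_rev; lia. Qed.

Lemma size_frame t : size (frame t) = (size t + 4)%N.
Proof. by rewrite /= size_cat /=; lia. Qed.

(** With [l = size t + 4], the reflected indices [2 l - j + 1] run from [l - 1] down to 3: they read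
    the final 2 and then [rev t], and leave out the three leading ones. *)
Lemma pqS_frame y t a j : a =1 nth 0 (frame t) ->
  pqS (size t + 4) y a j = nth 0 (frame (fold_core y t)) j.
Proof.
move=> aE; rewrite /pqS !aE.
case: ifP => [j1|/negbT]; rewrite -?ltnNge.
  case: j j1 => [|[|[|j]]] //= j1.
  by rewrite /fold_core -catA !nth_cat; have -> : (j < size t)%N by lia.
(* Count from the end of the common prefix, three ones followed by [t]. *)
move=> j1; have [i -> {j1}] : exists i, j = (i + (size t + 3))%N.
  by exists (j - (size t + 3))%N; lia.
have -> : nth 0 (frame (fold_core y t)) (i + (size t + 3)) =
    nth 0 ([:: 1; 1; y - 1; 2] ++ rev t ++ [:: 2]) i.
  rewrite (_ : i + (size t + 3) = (i + size t).+3)%N; last lia.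
  rewrite /frame /= /fold_core -catA nth_cat.
  have -> : (i + size t < size t)%N = false by lia.
  by rewrite addnK.
case: i => [|[|[|[|i]]]].
- by rewrite ifT //; lia.
- by rewrite ifF ?ifT //; lia.
- by do 2 (rewrite ifF; last lia); rewrite ifT //; lia.
- do 3 (rewrite ifF; last lia).
  rewrite ifT; last lia.
  rewrite (_ : _ - _ + 1 = (size t).+3)%N; last lia.
  by rewrite /= nth_cat ltnn subnn.
- do 3 (rewrite ifF; last lia).
  rewrite /= nth_cat size_rev.
  (* In turn: the reversed core, the indices out of range (0 on both sides), and the final 2. *)
  case: (ltngtP i (size t)) => it.
  + rewrite ifT; last lia.
    rewrite (_ : _ - _ + 1 = (size t - i.+1).+3)%N; last lia.
    by rewrite /= nth_cat nth_rev // ifT //; lia.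
  + rewrite !ifF; [|lia..].
    by rewrite nth_default //=; lia.
  + rewrite ifF; last lia.
    by rewrite ifT ?it ?subnn //; lia.
Qed.

Lemma pq_core z k j : pq z (k + 4) j = nth 0 (frame (core z k)) j.
Proof.
elim: k j => [|k IHk] j //.
rewrite addSn [LHS]/= ifF; last lia.
rewrite -(size_core z) (_ : (k + 4).+1 = k + 5)%N; last lia.
exact: pqS_frame.
Qed.

(** The coefficients come from [M(1)^3 = [[3, 2], [2, 1]]] on the left and the first column [(2, 1)]
    of [M(2)] on the right. *)
Lemma cfprod_frame t : let T := cfprod t in
  (cfprod (frame t) 0 0 = 6 * T 0 0 + 3 * T 0 1 + 4 * T 1 0 + 2 * T 1 1) *
  (cfprod (frame t) 1 0 = 4 * T 0 0 + 2 * T 0 1 + 2 * T 1 0 + T 1 1).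
Proof.
rewrite /frame /= !(cfprod_cons0, cfprod_cons1) cfprod_cat !mulmx2E.
by rewrite !(cfprod_cons0, cfprod_cons1) !cfprod_nilE; split; ring.
Qed.

(** The inserted block [1, 1, y - 1, 2] has matrix [y v v^T + J] with [v = (2, 1)] and [J =
    [[0, -1], [1, 0]]]. The first summand yields [y q p] and [y q^2]. Since [T J T^T = det(T) J],
    the second adds [(3, 2) J v = 1] to the numerator and [v^T J v = 0] to the denominator. *)
Lemma cfprod_fold y t : ~~ odd (size t) ->
  let p := cfprod (frame t) 0 0 in let q := cfprod (frame t) 1 0 in
  cfprod (frame (fold_core y t)) 0 0 = y * q * p + 1 /\
  cfprod (frame (fold_core y t)) 1 0 = q ^+ 2 * y.
Proof.
move=> t_even p q; rewrite /p /q.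
have revE i j : cfprod (rev t) i j = cfprod t j i by rewrite cfprod_rev mxE.
have catE u v i j : cfprod (u ++ v) i j =
    cfprod u i 0 * cfprod v 0 j + cfprod u i 1 * cfprod v 1 j.
  by rewrite cfprod_cat mulmx2E.
have wE j : let w := [:: 1, 1, y - 1, 2 & rev t] in
    (cfprod w 0 j = 4 * y * cfprod t j 0 + (2 * y - 1) * cfprod t j 1) *
    (cfprod w 1 j = (2 * y + 1) * cfprod t j 0 + y * cfprod t j 1).
  by rewrite /= !(cfprod_cons0, cfprod_cons1) !revE; split; ring.
have := cfprod_det t; rewrite -signr_odd (negbTE t_even) expr0.
rewrite !cfprod_frame /fold_core !catE !wE.
move: (cfprod t 0 0) (cfprod t 0 1) (cfprod t 1 0) (cfprod t 1 1) => e f g h det.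
by split; [rewrite -[X in _ = _ + X]det|]; ring.
Qed.

(** * The partial sums as continued fractions *)

Lemma xsS z n : (0 < n)%N -> xs z n.+1 = xs z n ^+ 2 * z n.+1.
Proof.
move=> n0; rewrite /xs big_nat_recr /=; last lia.
rewrite subnn expr1 -prodrXl; congr (_ * _); apply: eq_big_nat => j jn.
by rewrite -exprM subSn ?expnSr //; lia.
Qed.

Section PartialSums.
Variables (R : realType) (z : nat -> int).
Hypotheses (z2 : z 2%N = 2) (z_ge2 : forall n : nat, (3 <= n)%N -> 2 <= z n).

Let S_ (n : nat) : R := \sum_(1 <= j < n.+1) ((xs z j)%:~R)^-1.

Lemma xs_gt0 n : 0 < xs z n.
Proof.
rewrite /xs big_seq; apply: prodr_gt0 => j; rewrite mem_index_iota => jn.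
apply: exprn_gt0; case: (ltnP 2 j) => j2; first by have := z_ge2 j2; lia.
by rewrite (_ : j = 2%N) ?z2 //; lia.
Qed.

Lemma posseq_frame k : posseq (frame (core z k)).
Proof.
rewrite /frame /posseq /= all_cat /= andbT.
elim: k => [|k IHk] /=.
  by have := z_ge2 (leqnn 3); have := @z_ge2 4 isT; lia.
by rewrite all_cat /= all_rev IHk; have := @z_ge2 (k + 5)%N; lia.
Qed.

Lemma frame_core_xs k :
  cfprod (frame (core z k)) 1 0 = xs z (k + 4) /\
  S_ (k + 4) = (cfprod (frame (core z k)) 0 0)%:~R / (xs z (k + 4))%:~R.
Proof.
elim: k => [|k [IHq IHS]].
  have x1 : xs z 1 = 1 by rewrite /xs big_geq.
  have x2 : xs z 2 = 2 by rewrite xsS // x1 z2.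
  have x3 : xs z 3 = 4 * z 3%N by rewrite xsS // x2.
  have x4 : xs z 4 = 16 * z 3%N ^+ 2 * z 4%N by rewrite xsS // x3; ring.
  rewrite add0n /S_ 4?big_nat_recr //= big_geq // x1 x2 x3 x4.
  rewrite /= !(cfprod_cons0, cfprod_cons1) !cfprod_nilE.
  split; first by ring.
  have h3 : (z 3%N)%:~R != 0 :> R by rewrite intr_eq0; have := @z_ge2 3 isT; lia.
  have h4 : (z 4%N)%:~R != 0 :> R by rewrite intr_eq0; have := @z_ge2 4 isT; lia.
  by field; rewrite h3 h4.
have [ep eq] := cfprod_fold (z (k + 5)%N) (odd_size_core z k).
have xE : xs z (k.+1 + 4) = xs z (k + 4) ^+ 2 * z (k + 5)%N.
  by rewrite addSn xsS -?addnS //; lia.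
rewrite [core _ _]/= ep eq IHq xE; split=> //.
rewrite /S_ addSn big_nat_recr //= -/(S_ _) IHS -addSn xE.
have h1 : (xs z (k + 4))%:~R != 0 :> R by rewrite intr_eq0 gt_eqF ?xs_gt0.
have h2 : (z (k + 5)%N)%:~R != 0 :> R.
  by rewrite intr_eq0; have := @z_ge2 (k + 5)%N; lia.
by field; rewrite h1 h2.
Qed.

Lemma partial_sum_cfrac n : (4 <= n)%N -> S_ n = cfrac R (pq z n) (len n - 1).
Proof.
move=> n4; rewrite -(subnK n4); set k := (n - 4)%N.
have [q ->] := frame_core_xs k.
rewrite -q -(size_core z) (eq_cfrac _ (b := nth 0 (frame (core z k)))); last first.
  by move=> j _; apply: pq_core.
rewrite (_ : (size _ + 4 - 1)%N = (size (frame (core z k))).-1); last first.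
  by rewrite size_frame; lia.
by rewrite cfrac_cfprod // posseq_frame.
Qed.

(** * The limit sequence and convergence *)

Let a (j : nat) : int := pq z (j + 4) j.

(** Folding keeps all entries of a level but the last, and level [i + j + 4] has
    [10 * 2^(i + j) >= j + 10] entries. *)
Lemma pq_stable n j : (j + 4 <= n)%N -> pq z n j = a j.
Proof.
move=> jn; rewrite /a -(subnK jn); elim: (n - _)%N => [|i IHi] //.
rewrite -IHi addSn addnA -addSn !pq_core.
have : (j + 10 <= size (frame (core z (i + j))))%N.
  rewrite size_frame size_core /len (_ : i + j + 4 - 3 = (i + j).+1)%N; last lia.
  by have := ltn_expl (i + j) (isT : 1 < 2)%N; rewrite expnS; lia.
rewrite size_frame; case: j {jn IHi} => [|[|[|j]]] //= hj.
rewrite /fold_core -catA !nth_cat.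
by have -> : (j < size (core z (i + j.+3)))%N by lia.
Qed.

Lemma cfrac_partial_sum_dist m n : (0 < m)%N -> (m + 4 <= n)%N ->
  `|cfrac R a m - S_ n| <= m%:R^-1.
Proof.
move=> m0 mn; have n4 : (4 <= n)%N by lia.
set s := frame (core z (n - 4)).
have ms : (m.+1 < size s)%N.
  rewrite size_frame size_core subnK // /len (_ : n - 3 = (n - 4).+1)%N; last lia.
  by have := ltn_expl (n - 4) (isT : 1 < 2)%N; rewrite expnS; lia.
(* As [m + 4 <= n], the first [m + 1] entries of level [n] are already those of the limit. *)
have aE : cfrac R a m = cfrac R (nth 0 (take m.+1 s)) m.
  apply: eq_cfrac => j jm; rewrite nth_take // /s -pq_core subnK //.
  by rewrite (@pq_stable n) //; lia.
have ps : posseq s by apply: posseq_frame.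
have sz : size (take m.+1 s) = m.+1 by rewrite size_takel // ltnW.
have := @cfprod_prefix R (take m.+1 s) (drop m.+1 s).
rewrite cat_take_drop sz => /(_ ps m0).
have [<-] := frame_core_xs (n - 4); rewrite subnK // => ->.
rewrite aE.
have pt : posseq (take m.+1 s).
  by move: ps; rewrite -{1}(cat_take_drop m.+1 s) posseq_cat => /andP[].
have := cfrac_cfprod R pt.
by rewrite -[X in cfrac _ _ X]/(size (take m.+1 s)).-1 sz => <-.
Qed.

Lemma cvgn_partial_sum : cvgn S_.
Proof.
have S_homo : {homo S_ : n m / (n <= m)%N >-> n <= m}.
  apply/nondecreasing_seqP => n; rewrite /S_ (big_nat_recr n.+1) //= lerDl.
  by rewrite invr_ge0 ler0z ltW ?xs_gt0.
apply: nondecreasing_is_cvgn => //.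
(* The upper bound is the distance estimate for [m = 1], which holds from index 5 on; monotonicity
   covers the smaller indices. *)
exists (cfrac R a 1 + 1) => _ [n _ <-].
apply: (@le_trans _ _ (S_ (n + 5))); first by apply: S_homo; lia.
have : `|cfrac R a 1 - S_ (n + 5)| <= 1%:R^-1 by apply: cfrac_partial_sum_dist; lia.
by rewrite invr1 ler_norml => /andP[]; lra.
Qed.

Lemma cvg_cfrac_pq_limit : cfrac R a m @[m --> \oo] --> limn S_.
Proof.
(* The shift to [m.+1] meets the condition [0 < m] of the distance estimate and makes its bound the
   harmonic sequence. For fixed [m], the estimate then passes to the limit in [n]. *)
rewrite -cvg_shiftS; apply/cvgrPdist_le => e e0.
have := @cvg_harmonic R => /cvgrPdist_le /(_ e e0).
apply: filterS => m; rewrite sub0r normrN.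
rewrite ger0_norm ?invr_ge0 //; apply: le_trans.
have dist : \forall n \near \oo, `|cfrac R a m.+1 - S_ n| <= m.+1%:R^-1.
  by exists (m.+1 + 4)%N => // n mn; apply: cfrac_partial_sum_dist.
suff : `|limn S_ - cfrac R a m.+1| <= m.+1%:R^-1 by [].
move: (cfrac R a m.+1) (m.+1%:R^-1) dist => c d dist.
rewrite ler_norml; apply/andP; split.
  rewrite lerBrDr; apply: limr_ge; first exact: cvgn_partial_sum.
  by apply: filterS dist => n; rewrite ler_norml => /andP[]; lra.
rewrite lerBlDr; apply: limr_le; first exact: cvgn_partial_sum.
by apply: filterS dist => n; rewrite ler_norml => /andP[]; lra.
Qed.

Lemma mkseq_pq_limit : mkseq a 7 = [:: 1; 1; 1; z 3%N - 1; 2; z 4%N - 1; 1].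
(* By level [10 = 6 + 4] the entries of index at most 6 are settled. *)
Proof. by rewrite /mkseq /= -!(@pq_stable 10). Qed.

End PartialSums.

Theorem theorem6 (R : realType) (z : nat -> int)
    (z2 : z 2%N = 2) (z_ge2 : forall n : nat, (3 <= n)%N -> 2 <= z n) :
  let S_ (n : nat) : R := \sum_(1 <= j < n.+1) ((xs z j)%:~R)^-1 in
  (forall n : nat, (4 <= n)%N -> S_ n = cfrac R (pq z n) (len n - 1)) /\
  cvgn S_ /\
  exists a : nat -> int,
    [/\ forall j : nat, \forall n \near \oo, pq z n j = a j,
        cfrac R a m @[m --> \oo] --> limn S_ &
        mkseq a 7 = [:: 1; 1; 1; z 3%N - 1; 2; z 4%N - 1; 1]].
Proof.
move=> S_; split; first exact: partial_sum_cfrac.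
split; first exact: cvgn_partial_sum.
exists (fun j => pq z (j + 4) j); split.
- by move=> j; exists (j + 4)%N => // n /= jn; apply: pq_stable.
- exact: cvg_cfrac_pq_limit.
- exact: mkseq_pq_limit.
Qed.
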